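(* A Riemannian manifold $M$ is a $\mathfrak{C}$-space if and only if the geodesic symmetries $s_m$ preserve the eigenvalues of the Jacobi operators $R_{\gamma_v'(t)}$ along the geodesics $\gamma_v(t)$, for all $m\in M$ and all unit vectors $v\in T_mM$.
   Context: With $R(u,v)=[\nabla_u,\nabla_v]-\nabla_{[u,v]}$, the Jacobi operator of a unit vector $v$ is $R_vw=R(w,v)v$, considered on $v^\perp$. For a unit $v\in T_mM$, $\gamma_v$ is the geodesic with $\gamma_v(0)=m$, $\gamma_v'(0)=v$. The local geodesic symmetry $s_m$ is $\exp_m(x)\mapsto\exp_m(-x)$, so $s_m(\gamma_v(t))=\gamma_v(-t)=\gamma_{-v}(t)$. $M$ is a $\mathfrak{C}$-space if for each unit speed geodesic $\gamma$ the eigenvalues of $R_{\gamma'(t)}$ are constant along $\gamma$. The geodesic symmetries $s_m$ preserve the eigenvalues of the Jacobi operators along $\gamma_v$ if, for every $t$ for which these are defined, $R_{\gamma_v'(t)}|_{\gamma_v'(t)^\perp}$ and $R_{\gamma_{-v}'(t)}|_{\gamma_{-v}'(t)^\perp}$ have the same eigenvalues (with multiplicities). *)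

(* Defs.v *)
From HB Require Import structures.
From mathcomp Require Import all_boot all_order all_algebra.
From mathcomp Require Import all_classical all_reals all_analysis.
Set Implicit Arguments.
Unset Strict Implicit.
Unset Printing Implicit Defensive.
Import Order.TTheory GRing.Theory Num.Theory.
Import numFieldNormedType.Exports.
Local Open Scope classical_set_scope.
Local Open Scope ring_scope.

(* [Ck k f U] is meant for open U: f is of class C^k on U. Smoothness asks for
   it at all orders, so including differentiability in the step case does not
   change the meaning of [smooth_on]. *)
Fixpoint Ck (R : realType) (n : nat) (W : normedModType R) (k : nat)
    (f : 'rV[R]_n -> W) (U : set 'rV[R]_n) : Prop :=
  match k with
  | 0 => forall x, U x -> {for x, continuous f}
  | k'.+1 => (forall x, U x -> differentiable f x) /\
             (forall v : 'rV[R]_n, Ck k' ('D_v f) U)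
  end.

Definition smooth_on (R : realType) (n : nat) (W : normedModType R)
    (U : set 'rV[R]_n) (f : 'rV[R]_n -> W) : Prop :=
  forall k, Ck k f U.

Record chart (R : realType) (n : nat) (M : topologicalType) := Chart {
  chart_dom : set M;
  chart_map :> M -> 'rV[R]_n;
  chart_inv : 'rV[R]_n -> M;
  chart_dom_open : open chart_dom;
  chart_img_open : open (chart_map @` chart_dom);
  chart_mapK : forall p, chart_dom p -> chart_inv (chart_map p) = p;
  chart_map_cont : forall p, chart_dom p -> {for p, continuous chart_map};
  chart_inv_cont : forall x, (chart_map @` chart_dom) x ->
    {for x, continuous chart_inv} }.

Record smooth_manifold (R : realType) (n : nat) := SmoothManifold {
  manifold_sort :> topologicalType;
  manifold_hausdorff : hausdorff_space manifold_sort;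
  manifold_second_countable : @second_countable manifold_sort;
  atlas : set (chart R n manifold_sort);
  atlas_cover : forall p : manifold_sort,
    exists c, atlas c /\ chart_dom c p;
  atlas_smooth : forall c c', atlas c -> atlas c' ->
    smooth_on (c @` (chart_dom c `&` chart_dom c')) (c' \o chart_inv c) }.

(* A chosen chart of the atlas around p. *)
Definition chart_at (R : realType) (n : nat) (M : smooth_manifold R n) (p : M)
    : chart R n M :=
  sval (cid (atlas_cover p)).

(* The tangent space at p, identified with R^n by the coordinates of
   [chart_at p]. Nothing intrinsic depends on the choice of this chart. *)
Definition tangent (R : realType) (n : nat) (M : smooth_manifold R n) (p : M)
    : Type := 'rV[R]_n.

(* [metric_in g c x] is the Gram matrix at the point with coordinates x of the
   coordinate frame of c, where [g p] is the Gram matrix on [tangent p]. Row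
   vectors change coordinates by right multiplication by the Jacobian. *)
Definition metric_in (R : realType) (n : nat) (M : smooth_manifold R n)
    (g : M -> 'M[R]_n) (c : chart R n M) (x : 'rV[R]_n) : 'M[R]_n :=
  let p := chart_inv c x in
  let J := 'J (chart_at p \o chart_inv c) x in
  J *m g p *m J^T.

Record riemannian_manifold (R : realType) (n : nat) := RiemannianManifold {
  base_manifold :> smooth_manifold R n;
  metric : base_manifold -> 'M[R]_n;
  metric_sym : forall p, (metric p)^T = metric p;
  metric_pos : forall p (v : tangent p), v != 0 ->
    0 < (v *m metric p *m v^T) 0 0;
  metric_smooth : forall c, atlas c ->
    smooth_on (c @` chart_dom c) (metric_in metric c) }.

Section LocalGeometry.
Variables (R : realType) (n : nat) (G : 'rV[R]_n -> 'M[R]_n).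
Implicit Types X Y Z : 'rV[R]_n -> 'rV[R]_n.

Let e (i : 'I_n) : 'rV[R]_n := delta_mx 0 i.

(* Gamma^k_ij = 1/2 g^kl (d_i g_jl + d_j g_il - d_l g_ij) *)
Definition christoffel (x : 'rV[R]_n) (k i j : 'I_n) : R :=
  2^-1 * \sum_l invmx (G x) k l *
    (('D_(e i) G x) j l + ('D_(e j) G x) i l - ('D_(e l) G x) i j).

Definition christoffel_form (x u v : 'rV[R]_n) : 'rV[R]_n :=
  \row_k \sum_i \sum_j christoffel x k i j * u 0 i * v 0 j.

(* The Levi-Civita connection of G on vector fields in coordinates. *)
Definition nabla X Y : 'rV[R]_n -> 'rV[R]_n :=
  fun x => 'D_(X x) Y x + christoffel_form x (X x) (Y x).

Definition lie_bracket X Y : 'rV[R]_n -> 'rV[R]_n :=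
  fun x => 'D_(X x) Y x - 'D_(Y x) X x.

Definition curvature X Y Z : 'rV[R]_n -> 'rV[R]_n :=
  fun x => nabla X (nabla Y Z) x - nabla Y (nabla X Z) x
           - nabla (lie_bracket X Y) Z x.

End LocalGeometry.

Section Geometry.
Variables (R : realType) (n : nat) (M : riemannian_manifold R n).

Definition inner (p : M) (u v : tangent p) : R := (u *m metric p *m v^T) 0 0.

Definition unit_vector (p : M) (v : tangent p) : Prop := inner v v = 1.

(* R_v w = R(w, v) v. Curvature being tensorial, w and v are extended by
   vector fields with constant coordinates. *)
Definition jacobi (p : M) (v w : tangent p) : tangent p :=
  curvature (metric_in (@metric R n M) (chart_at p))
    (cst w) (cst v) (cst v) (chart_at p p).

(* [kermx (metric p *m v^T)] is the orthogonal complement of v. By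
   self-adjointness, geometric and algebraic multiplicities agree. The
   multiplicity is 0 when a is not an eigenvalue. *)
Definition jacobi_multiplicity (p : M) (v : tangent p) (a : R) : nat :=
  \rank (eigenspace (lin1_mx (jacobi v)) a :&: kermx (metric p *m v^T))%MS.

Definition same_jacobi_eigenvalues (p : M) (u : tangent p)
    (q : M) (v : tangent q) : Prop :=
  forall a : R, jacobi_multiplicity u a = jacobi_multiplicity v a.

Definition velocity (gamma : R -> M) (t : R) : tangent (gamma t) :=
  derive1 (chart_at (gamma t) \o gamma) t.

Definition geodesic (gamma : R -> M) (I : set R) : Prop :=
  [/\ open I, is_interval I,
      forall t, I t -> {for t, continuous gamma} &
      forall c, atlas c -> forall t, I t -> chart_dom c (gamma t) ->
        let x := c \o gamma in let dx := derive1 x in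
        [/\ derivable x t 1, derivable dx t 1 &
            derive1 dx t +
              christoffel_form (metric_in (@metric R n M) c)
                (x t) (dx t) (dx t) = 0]].

Definition unit_speed_geodesic (gamma : R -> M) (I : set R) : Prop :=
  geodesic gamma I /\ forall t, I t -> unit_vector (velocity gamma t).

Definition C_space : Prop :=
  forall (gamma : R -> M) (I : set R), unit_speed_geodesic gamma I ->
  forall s t, I s -> I t ->
    same_jacobi_eigenvalues (velocity gamma s) (velocity gamma t).

(* gamma, on the open interval I, is a piece of the geodesic with initial
   velocity v; two such pieces agree wherever both are defined. *)
Definition geodesic_from (m : M) (v : tangent m) (gamma : R -> M)
    (I : set R) : Prop :=
  [/\ geodesic gamma I, I 0, gamma 0 = m & velocity gamma 0 = v].

Definition opp_tangent (m : M) (v : tangent m) : tangent m :=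
  - (v : 'rV[R]_n).

(* gamma' is gamma_{-v}, and s_m maps gamma t = gamma_v(t) to gamma' t. *)
Definition symmetry_preserves_jacobi_eigenvalues (m : M) (v : tangent m)
    : Prop :=
  forall (gamma gamma' : R -> M) (I I' : set R),
    geodesic_from v gamma I -> geodesic_from (opp_tangent v) gamma' I' ->
    forall t, I t -> I' t ->
      same_jacobi_eigenvalues (velocity gamma t) (velocity gamma' t).

End Geometry.

Arguments C_space {R n} M.

(* Main.v *)
Require Import Defs.
From mathcomp Require Import all_boot all_order all_algebra.
From mathcomp Require Import all_classical all_reals all_analysis.
From mathcomp Require Import ring lra.
Set Implicit Arguments.
Unset Strict Implicit.
Unset Printing Implicit Defensive.
Import Order.TTheory GRing.Theory Num.Theory.
Import numFieldNormedType.Exports.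
Local Open Scope classical_set_scope.
Local Open Scope ring_scope.

(** Both implications relate the Jacobi operators along a geodesic to those
    along the same geodesic run backwards, through the identity
    R_{-v} = R_v ([jacobi_multiplicity_oppr]): the Jacobi operator is quadratic
    in v.

    If M is a C-space, then along gamma_v and along gamma_{-v} the eigenvalues
    keep the values they have at the common starting point m, namely those of
    R_v and of R_{-v}, which coincide. Constancy is assumed along unit speed
    geodesics only, while gamma_v is only known to have a unit initial velocity;
    what closes the gap is that a geodesic has constant speed
    ([geodesic_cst_speed]), which is the compatibility of the Levi-Civita
    connection with the metric.

    Conversely, let gamma be a unit speed geodesic and s, t two of its
    parameters. The geodesic symmetry at the midpoint gamma((s + t) / 2) sends
    gamma(t) to gamma(s), and the geodesic with the opposite initial velocity
    is gamma with time reversed, whose velocity at gamma(s) is - gamma'(s).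
    Hence R_{gamma'(t)} and R_{- gamma'(s)} = R_{gamma'(s)} have the same
    eigenvalues. That gamma shifted, or shifted and reversed, is again a geodesic
    is an instance of invariance under affine changes of parameter
    ([geodesic_from_affine]).

    Constancy of the speed near time t is checked in the chart chosen at
    gamma(t), where the squared speed is x' G(x) x'^T. Differentiating and
    inserting the geodesic equation x'' = - Gamma(x', x') leaves the cubic form
    sum_ijk x'_i x'_j x'_k d_k G_ij minus twice x' G Gamma(x', x')^T, and the
    definition of the Christoffel symbols makes the latter the same cubic form
    ([christoffel_form_compat]). *)

(** * Calculus along curves *)

Section OneVariable.
Variables (R : realType).

(** The difference quotients of the two sides agree after the substitution of
    - h for h, so the limits agree even where f has no derivative. *)
Lemma derive_oppr (V W : normedModType R) (f : V -> W) (a v : V) :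
  'D_(- v) (fun x => - f x) a = 'D_v f a.
Proof.
rewrite /derive /=.
suff -> : (fun h : R => h^-1 *: (- f (h *: - v + a) - - f a)) @ 0^' =
  (fun h : R => h^-1 *: (f (h *: v + a) - f a)) @ 0^' by [].
have {1}-> : (0 : R)^' = -%R @ (0 : R)^'.
  rewrite -{1}oppr0 dnbhsN; apply/seteqP; split=> [_ [A nA <-]|A nA].
    by apply: filterS nA => x Ax; exists x.
  exists (-%R @^-1` A) => //; apply/seteqP; split=> [_ [x Ax <-]//|x Ax].
  by exists (- x) => /=; rewrite opprK.
apply/funext => A; rewrite /nbhs/=; congr (_ _ _).
apply/funext => h /=; congr (A _).
by rewrite scalerN scaleNr opprK invrN scaleNr -scalerN opprB addrC opprK.
Qed.

Lemma derive1_comp_diff (V W : normedModType R) (f : V -> W) (x : R -> V)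
    (t : R) : derivable x t 1 -> differentiable f (x t) ->
  derivable (f \o x) t 1 /\ derive1 (f \o x) t = 'd f (x t) (derive1 x t).
Proof.
move=> /derivable1_diffP dx df; split.
  by apply/derivable1_diffP; exact: differentiable_comp.
by rewrite !derive1E'//; [rewrite diff_comp|exact: differentiable_comp].
Qed.

Lemma derive1_affine (W : normedModType R) (f : R -> W) (s e t : R) :
  derivable f (s + e * t) 1 ->
  derivable (fun u => f (s + e * u)) t 1 /\
  derive1 (fun u => f (s + e * u)) t = e *: derive1 f (s + e * t).
Proof.
move=> fd.
have ad : is_derive t 1 (fun u => s + e * u) e.
  apply: is_derive_eq. rewrite add0r mul1r; exact: mulr1.
have da : derivable (fun u => s + e * u) t 1 by [].
have fdiff : differentiable f (s + e * t) by exact/derivable1_diffP.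
have [fad ->] := derive1_comp_diff da fdiff; split=> //=.
rewrite (derive1E' fdiff).
rewrite derive1E derive_val -linearZ; congr ('d _ _ _); exact/esym/mulr1.
Qed.

Lemma derive0_cst_on_interval (f : R -> R) (I : set R) :
  is_interval I -> (forall t, I t -> is_derive t 1 f 0) ->
  forall s t, I s -> I t -> f s = f t.
Proof.
move=> Iint df.
suff H s t : s <= t -> I s -> I t -> f s = f t.
  by move=> s t Is It; case: (leP s t) => [|/ltW] le; [|symmetry]; exact: H.
move=> st Is It.
have Ist u : u \in `[s, t] -> I u.
  by rewrite in_itv/=; exact: Iint.
have [||c _] := @MVT_segment R f (fun=> 0) s t st.
- by move=> u ust; apply: df; apply: Ist; exact: subset_itv_oo_cc ust.
- apply: derivable_within_continuous => u /Ist /df []//.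
by move=> /= /eqP; rewrite mul0r subr_eq0 => /eqP.
Qed.

End OneVariable.

(** * The Christoffel form and the curvature in coordinates *)

Section Local.
Variables (R : realType) (n : nat) (G : 'rV[R]_n -> 'M[R]_n).

Lemma christoffel_formZ (x u v : 'rV[R]_n) (a b : R) :
  christoffel_form G x (a *: u) (b *: v) = (a * b) *: christoffel_form G x u v.
Proof.
apply/rowP => k; rewrite !mxE mulr_sumr; apply: eq_bigr => i _.
rewrite mulr_sumr; apply: eq_bigr => j _; rewrite !mxE; ring.
Qed.

(** For fields with constant coordinates each covariant derivative is a value or
    a derivative of the Christoffel form, and the two signs cancel in every
    term. *)
Lemma curvature_oppr (x v w : 'rV[R]_n) :
  curvature G (cst w) (cst (- v)) (cst (- v)) x =
  curvature G (cst w) (cst v) (cst v) x.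
Proof.
have nabla_cst (a b : 'rV[R]_n) :
    nabla G (cst a) (cst b) = fun y => christoffel_form G y a b.
  by apply/funext => y; rewrite /nabla derive_cst add0r.
have bracket0 (a b : 'rV[R]_n) : lie_bracket (cst a) (cst b) = cst 0.
  by apply/funext => y; rewrite /lie_bracket !derive_cst subr0.
have form0 y (b : 'rV[R]_n) : christoffel_form G y 0 b = 0.
  by have := christoffel_formZ y 0 b 0 1; rewrite scale0r scale1r mul0r scale0r.
have formNr y (a b : 'rV[R]_n) :
    christoffel_form G y a (- b) = - christoffel_form G y a b.
  by have := christoffel_formZ y a b 1 (- 1); rewrite scale1r mul1r !scaleN1r.
have formNl y (a b : 'rV[R]_n) :
    christoffel_form G y (- a) b = - christoffel_form G y a b.
  by have := christoffel_formZ y a b (- 1) 1; rewrite scale1r mulr1 !scaleN1r.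
rewrite /curvature !bracket0 !nabla_cst.
rewrite (_ : (fun y => christoffel_form G y (- v) (- v)) =
             (fun y => christoffel_form G y v v)); last first.
  by apply/funext => y; rewrite formNl formNr opprK.
rewrite (_ : (fun y => christoffel_form G y w (- v)) =
             (fun y => - christoffel_form G y w v)); last first.
  by apply/funext => y; rewrite formNr.
congr (_ - _ - _).
  by rewrite /nabla derive_oppr formNl formNr opprK.
by rewrite !form0.
Qed.

(** Lowering the index of the Christoffel form removes the inverse metric. *)
Lemma mulmx_christoffel_form (x a : 'rV[R]_n) : G x \in unitmx ->
  G x *m (christoffel_form G x a a)^T =
  \col_l (2^-1 * \sum_i \sum_j
    (('D_(delta_mx 0 i) G x) j l + ('D_(delta_mx 0 j) G x) i l
     - ('D_(delta_mx 0 l) G x) i j) * a 0 i * a 0 j).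
Proof.
move=> Gu; set S := (RHS).
suff -> : (christoffel_form G x a a)^T = invmx (G x) *m S by rewrite mulKVmx.
apply/colP => k; rewrite !mxE.
under eq_bigr do under eq_bigr do
  rewrite /christoffel -!mulrA mulr_suml mulr_sumr.
under [RHS]eq_bigr do rewrite mxE !mulr_sumr.
rewrite [RHS]exchange_big/=; apply: eq_bigr => i _.
under [RHS]eq_bigr do rewrite !mulr_sumr.
rewrite [RHS]exchange_big/=; apply: eq_bigr => j _.
apply: eq_bigr => l _; ring.
Qed.

(** Contracted with a three times, the three derivatives in the Christoffel
    symbol of the first kind all become the same cubic form, with signs +, +, -. *)
Lemma christoffel_form_compat (x a : 'rV[R]_n) : G x \in unitmx ->
  (a *m G x *m (christoffel_form G x a a)^T) 0 0 =
  2^-1 * \sum_i \sum_j \sum_k a 0 k * ('D_(delta_mx 0 k) G x) i j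
                               * a 0 i * a 0 j.
Proof.
move=> Gu; rewrite -mulmxA mulmx_christoffel_form// mxE.
set T := fun i j k => a 0 k * ('D_(delta_mx 0 k) G x) i j * a 0 i * a 0 j.
have -> : \sum_i \sum_j \sum_k T i j k =
  \sum_l \sum_i \sum_j (T j l i + T i l j - T i j l).
  under [RHS]eq_bigr do under eq_bigr do rewrite sumrB big_split/=.
  under [RHS]eq_bigr do rewrite sumrB big_split/=.
  rewrite sumrB big_split/=.
  have -> : \sum_l \sum_i \sum_j T j l i = \sum_i \sum_j \sum_k T i j k.
    rewrite exchange_big/= [RHS]exchange_big/=.
    under [RHS]eq_bigr do rewrite exchange_big/=.
    by rewrite [RHS]exchange_big.
  have -> : \sum_l \sum_i \sum_j T i l j = \sum_i \sum_j \sum_k T i j k.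
    by rewrite exchange_big.
  have -> : \sum_l \sum_i \sum_j T i j l = \sum_i \sum_j \sum_k T i j k.
    rewrite exchange_big/=; apply: eq_bigr => i _; by rewrite exchange_big.
  by rewrite addrK.
rewrite mulr_sumr; apply: eq_bigr => l _; rewrite mxE mulrCA; congr (_ * _).
rewrite mulr_sumr; apply: eq_bigr => i _.
rewrite mulr_sumr; apply: eq_bigr => j _; rewrite /T; ring.
Qed.

(** Conservation of the squared speed along a solution of the geodesic equation
    in coordinates: the two terms that contain the acceleration are equal by
    symmetry of G, and together they cancel the derivative of G along x. *)
Lemma is_derive_sqnorm (x : R -> 'rV[R]_n) (t : R) :
  derivable x t 1 -> derivable (derive1 x) t 1 -> differentiable G (x t) ->
  G (x t) \in unitmx -> (G (x t))^T = G (x t) ->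
  derive1 (derive1 x) t + christoffel_form G (x t) (derive1 x t) (derive1 x t) = 0 ->
  is_derive t 1 (fun s => (derive1 x s *m G (x s) *m (derive1 x s)^T) 0 0) 0.
Proof.
set a := derive1 x => dx da dG Gu Gs geo.
have [dGx GxE] := derive1_comp_diff dx dG.
have aD i : is_derive t 1 (fun s => a s 0 i) (derive1 a t 0 i).
  split; first by move/derivable_mxP : da.
  by rewrite derive1E derive_mx// mxE.
have GD i j : is_derive t 1 (fun s => G (x s) i j)
    (\sum_k a t 0 k * ('D_(delta_mx 0 k) G (x t)) i j).
  split; first by move/derivable_mxP : dGx; exact.
  transitivity (derive1 (G \o x) t i j); first by rewrite derive1E derive_mx// mxE.
  rewrite GxE -/a [X in 'd _ _ X]row_sum_delta linear_sum/= summxE.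
  by apply: eq_bigr => k _; rewrite linearZ/= mxE deriveE.
have formE (A : 'M[R]_n) (u v : 'rV[R]_n) :
    (u *m A *m v^T) 0 0 = \sum_i \sum_j u 0 i * (A i j * v 0 j).
  rewrite mxE; under eq_bigr do rewrite !mxE mulr_suml.
  rewrite exchange_big/=; apply: eq_bigr => i _.
  by apply: eq_bigr => j _; rewrite mulrA.
have -> : (fun s => (a s *m G (x s) *m (a s)^T) 0 0) =
   \sum_i \sum_j (fun s => a s 0 i) * ((fun s => G (x s) i j) * (fun s => a s 0 j)).
  apply/funext => s; rewrite fct_sumE formE; apply: eq_bigr => i _.
  by rewrite fct_sumE.
pose b := derive1 a t.
have := christoffel_form_compat (a t) Gu.
have -> : christoffel_form G (x t) (a t) (a t) = - b.
  by apply/eqP; rewrite -addr_eq0 addrC geo.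
rewrite raddfN mulmxN mxE => /(canLR (mulKf (invr_neq0 _))) compat.
have sym : (b *m G (x t) *m (a t)^T) 0 0 = (a t *m G (x t) *m b^T) 0 0.
  rewrite -[in LHS](trmxK (b *m _ *m _)) mxE !trmx_mul trmxK Gs mulmxA.
  by [].
have mulfE (f g : R -> R) : (f * g) t = f t * g t by [].
apply: is_derive_eq.
transitivity ((a t *m G (x t) *m b^T) 0 0 +
  \sum_i \sum_j \sum_k a t 0 k * ('D_(delta_mx 0 k) G (x t)) i j
                               * a t 0 i * a t 0 j
  + (b *m G (x t) *m (a t)^T) 0 0).
  rewrite !formE -!big_split/=; apply: eq_bigr => i _.
  rewrite -!big_split/=; apply: eq_bigr => j _.
  rewrite /GRing.scale/= mulfE -!mulr_suml /b; ring.
rewrite sym -compat ?pnatr_eq0//; lra.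
Qed.

End Local.

(** * Geodesics on a Riemannian manifold *)

Section Manifold.
Variables (R : realType) (n : nat) (M : riemannian_manifold R n).
Implicit Types (p q : M) (c : chart R n M) (gamma : R -> M) (I : set R).

Let G := metric_in (@metric R n M).

Lemma atlas_chart_at p : atlas (chart_at p).
Proof. by rewrite /chart_at; case: cid => c []. Qed.

Lemma chart_at_dom p : chart_dom (chart_at p) p.
Proof. by rewrite /chart_at; case: cid => c []. Qed.

(** R_{-v} = R_v, and v and - v have the same orthogonal complement. *)
Lemma jacobi_multiplicity_oppr p (v : tangent p) a :
  jacobi_multiplicity (opp_tangent v) a = jacobi_multiplicity v a.
Proof.
rewrite /jacobi_multiplicity.
have -> : jacobi (opp_tangent v) = jacobi v.
  by apply/funext => w; exact: curvature_oppr.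
suff : (kermx (metric p *m (opp_tangent v)^T) :=: kermx (metric p *m v^T))%MS.
  by move=> eqk; apply: eqmx_rank; apply/eqmxP; exact: cap_eqmx.
have ker_oppr (B : 'cV[R]_n) : (kermx (- B) <= kermx B)%MS.
  by apply/sub_kermxP; rewrite -[B]opprK mulmxN opprK mulmx_ker oppr0.
rewrite /opp_tangent linearN mulmxN; apply/eqmxP/andP; split=> //.
by rewrite -[X in (kermx X <= _)%MS]opprK ker_oppr.
Qed.

Lemma metric_in_sym c x : (G c x)^T = G c x.
Proof. by rewrite /G /metric_in !trmx_mul trmxK Defs.metric_sym mulmxA. Qed.

Lemma unitmx_metric p : metric p \in unitmx.
Proof.
rewrite -row_free_unit -kermx_eq0; apply/eqP/row_matrixP => i.
rewrite row0; apply/eqP; apply: contraT => v0.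
have := metric_pos (p := p) v0.
by rewrite -row_mul mulmx_ker row0 mul0mx mxE ltxx.
Qed.

Lemma chart_invK_near c p : chart_dom c p ->
  \forall y \near c p, c (chart_inv c y) = y.
Proof.
move=> cp; have : nbhs (c p) (c @` chart_dom c).
  by apply: open_nbhs_nbhs; split; [exact: chart_img_open|exists p].
by apply: filterS => _ [q cq <-]; rewrite chart_mapK.
Qed.

(** The transition map from the chosen chart to itself is the identity near the
    image of p, so its Jacobian there is the identity matrix. *)
Lemma metric_in_chart_at p : G (chart_at p) (chart_at p p) = metric p.
Proof.
have cp := chart_at_dom p.
rewrite /G /metric_in chart_mapK//.
suff -> : 'J (chart_at p \o chart_inv (chart_at p)) (chart_at p p) = 1%:M.
  by rewrite trmx1 mulmx1 mul1mx.
set tau := _ \o _.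
have taud : differentiable tau (chart_at p p).
  have := @atlas_smooth _ _ M _ _ (atlas_chart_at p) (atlas_chart_at p) 1%N.
  by case=> + _; apply; exists p.
apply/row_matrixP => i; rewrite !rowE -deriveEjacobian// mulmx1.
rewrite -[RHS](derive_id (chart_at p p)).
by apply: near_eq_derive; exact: chart_invK_near.
Qed.

Lemma geodesic_near gamma I c t : geodesic gamma I -> I t ->
  chart_dom c (gamma t) ->
  \forall s \near t, I s /\ chart_dom c (gamma s).
Proof.
move=> [Iopen _ gcont _] It ct; apply: filterI; first exact: open_nbhs_nbhs.
apply: (gcont t It); apply: open_nbhs_nbhs; split=> //; exact: chart_dom_open.
Qed.

(** The velocity is read in a chart that varies with t; this brings it to a
    fixed chart c, by the chain rule applied to the transition map. *)
Lemma velocity_chart gamma I c t : geodesic gamma I -> atlas c -> I t ->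
  chart_dom c (gamma t) ->
  velocity gamma t = derive1 (c \o gamma) t *m
    'J (chart_at (gamma t) \o chart_inv c) (c (gamma t)).
Proof.
move=> ggamma ac It ct; set c' := chart_at (gamma t).
have [_ _ _ /(_ c ac t It ct) [dx _ _]] := ggamma.
have taud : differentiable (c' \o chart_inv c) ((c \o gamma) t).
  have [+ _] := atlas_smooth ac (atlas_chart_at (gamma t)) 1%N.
  apply; exists (gamma t) => //; split=> //; exact: chart_at_dom.
have [_ comp] := derive1_comp_diff dx taud.
rewrite -deriveEjacobian// deriveE// -comp /velocity !derive1E.
apply: near_eq_derive.
apply: filterS (geodesic_near ggamma It ct) => s [_ cs] /=.
by rewrite chart_mapK.
Qed.

Lemma inner_velocity_chart gamma I c t : geodesic gamma I -> atlas c -> I t ->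
  chart_dom c (gamma t) ->
  inner (velocity gamma t) (velocity gamma t) =
  (derive1 (c \o gamma) t *m G c (c (gamma t))
    *m (derive1 (c \o gamma) t)^T) 0 0.
Proof.
move=> ggamma ac It ct; rewrite /inner (velocity_chart ggamma ac It ct).
by rewrite /G /metric_in chart_mapK// trmx_mul !mulmxA.
Qed.

(** The derivative of the squared speed at t is computed in the chart at
    gamma t: the fixed-chart formula holds for all nearby times, and at t itself
    the Gram matrix is the metric, hence invertible. *)
Lemma geodesic_cst_speed gamma I : geodesic gamma I ->
  forall s t, I s -> I t ->
  inner (velocity gamma s) (velocity gamma s) =
  inner (velocity gamma t) (velocity gamma t).
Proof.
move=> ggamma; have [_ Iint _ geo] := ggamma.
apply: derive0_cst_on_interval => // t It.
pose c := chart_at (gamma t).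
have ac : atlas c by exact: atlas_chart_at.
have ct : chart_dom c (gamma t) by exact: chart_at_dom.
have [dx ddx eqx] := geo c ac t It ct.
apply: near_eq_is_derive (is_derive_sqnorm dx ddx _ _ _ eqx).
- apply: filterS (geodesic_near ggamma It ct) => s [Is cs].
  by rewrite (inner_velocity_chart ggamma ac Is cs).
- by have [+ _] := metric_smooth ac 1%N; apply; exists (gamma t).
- by rewrite [X in X \in _]metric_in_chart_at unitmx_metric.
- exact: metric_in_sym.
Qed.

(** The velocity is multiplied by e, while the acceleration and the Christoffel
    form, which is quadratic in the velocity, are both multiplied by e ^ 2. *)
Lemma geodesic_affine gamma I (s e : R) : geodesic gamma I ->
  geodesic (fun t => gamma (s + e * t)) [set t | I (s + e * t)].
Proof.
move=> ggamma; have [Iopen Iint gcont geo] := ggamma.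
have affc : continuous (fun t : R => s + e * t).
  by move=> t; apply: cvgD; [exact: cvg_cst|exact: mulrl_continuous].
split.
- exact: open_comp.
- move=> t u /= It Iu w /andP[tw wu].
  have [e0|/ltW e0] := leP 0 e.
    by apply: Iint It Iu _ _; rewrite !lerD2l !ler_wpM2l.
  by apply: Iint Iu It _ _; rewrite !lerD2l !ler_wnM2l.
- move=> t It; apply: continuous_comp; [exact: affc|exact: gcont].
move=> c ac t It ct x dx.
have [dy ddy eqy] := geo c ac _ It ct.
set y := c \o gamma in dy ddy eqy.
(* A second derivative needs the first one at all nearby times. *)
have near_dx : \near t, e *: derive1 y (s + e * t) = dx t.
  have : \near t, I (s + e * t) /\ chart_dom c (gamma (s + e * t)).
    exact: affc (geodesic_near ggamma It ct).
  apply: filterS => u [Iu cu].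
  by have [/derive1_affine [_ <-] _ _] := geo c ac _ Iu cu.
have [xd xE] := derive1_affine dy.
have [yd yE] := derive1_affine ddy.
split; first exact: xd.
  by apply: (near_eq_derivable near_dx); exact: derivableZ.
rewrite derive1E -(near_eq_derive _ near_dx) deriveZ//= -derive1E yE /dx xE.
by rewrite christoffel_formZ scalerA -scalerDr eqy scaler0.
Qed.

Lemma velocity_affine gamma I (s e t : R) : geodesic gamma I ->
  I (s + e * t) ->
  velocity (fun u => gamma (s + e * u)) t = e *: velocity gamma (s + e * t).
Proof.
move=> [_ _ _ geo] It.
have [dx _ _] := geo _ (atlas_chart_at _) _ It (chart_at_dom _).
exact: (derive1_affine dx).2.
Qed.

(** With e = 1 this restarts the geodesic at time s; with e = - 1 it is also
    reversed, which makes it the geodesic with the opposite initial velocity. *)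
Lemma geodesic_from_affine gamma I (s e : R) : geodesic gamma I -> I s ->
  geodesic_from (e *: (velocity gamma s : 'rV[R]_n) : tangent (gamma s))
    (fun t => gamma (s + e * t)) [set t | I (s + e * t)].
Proof.
move=> ggamma Is; have Is0 : I (s + e * 0) by rewrite mulr0 addr0.
split; [exact: geodesic_affine|exact: Is0|by rewrite mulr0 addr0|].
by rewrite (velocity_affine ggamma Is0) mulr0 addr0.
Qed.

Lemma unit_vector_opp p (v : tangent p) :
  unit_vector v -> unit_vector (opp_tangent v).
Proof.
by rewrite /unit_vector /inner /opp_tangent linearN mulNmx mulmxN mulNmx opprK.
Qed.

(** The unit length of v spreads along gamma by constancy of the speed, so that
    the C-space property applies between the times t and 0. *)
Lemma C_space_geodesic_from p (v : tangent p) gamma I t : C_space M ->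
  unit_vector v -> geodesic_from v gamma I -> I t ->
  same_jacobi_eigenvalues (velocity gamma t) v.
Proof.
move=> CM vunit [ggamma I0 gp gv] It a.
(* The tangent spaces at gamma 0 and at p are both R^n, so that u needs no
   cast. *)
have transport q (e : q = p) (u : 'rV[R]_n) :
    @jacobi_multiplicity R n M q u a = @jacobi_multiplicity R n M p u a.
  by case: p / e {v vunit gp gv}.
rewrite (CM gamma I _ t 0 It I0 a); first by rewrite gv; exact: transport.
split=> // s Is; rewrite /unit_vector (geodesic_cst_speed ggamma Is I0) gv.
by rewrite /inner gp.
Qed.

End Manifold.

Theorem proposition5p6 (R : realType) (n : nat) (M : riemannian_manifold R n) :
  C_space M <->
  (forall (m : M) (v : tangent m), unit_vector v ->
     symmetry_preserves_jacobi_eigenvalues v).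
Proof.
split=> [CM m v vunit gamma gamma' I I' from_v from_Nv t It It' a
        |sym gamma I [ggamma gunit] s t Is It a].
  rewrite (C_space_geodesic_from CM vunit from_v It).
  have Nvunit := unit_vector_opp vunit.
  rewrite (C_space_geodesic_from CM Nvunit from_Nv It').
  by rewrite jacobi_multiplicity_oppr.
have [_ Iint _ _] := ggamma.
pose m := (s + t) / 2; pose h := (t - s) / 2.
have mt : m + 1 * h = t by rewrite /m /h; lra.
have ms : m + (- 1) * h = s by rewrite /m /h; lra.
have Im : I m.
  have [st|/ltW ts] := leP s t; first by apply: Iint Is It _ _; rewrite /m; lra.
  by apply: Iint It Is _ _; rewrite /m; lra.
have It' : I (m + 1 * h) by rewrite mt.
have Is' : I (m + (- 1) * h) by rewrite ms.
have from_v := geodesic_from_affine 1 ggamma Im.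
have from_Nv := geodesic_from_affine (- 1) ggamma Im.
rewrite scale1r in from_v; rewrite scaleN1r in from_Nv.
have := sym _ _ (gunit m Im) _ _ _ _ from_v from_Nv h It' Is' a.
rewrite (velocity_affine ggamma It') (velocity_affine ggamma Is').
by rewrite scale1r scaleN1r jacobi_multiplicity_oppr mt ms => ->.
Qed.
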